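(* Let $\mathbb{F}_q$ be a finite field with $q$ elements, let $B\in\mathbb{F}_q[x]$ be a polynomial of positive degree, and let $M\in\mathbb{F}_q[x]$ be a polynomial of positive degree. Suppose that $M$ is coprime to $B(B-1)$. Let $T$ be the order of $B$ in the multiplicative group $(\mathbb{F}_q[x]/(M))^*$, and let $$\frac{1}{M} = \sum_{j\ge 1} a_j(x)\,B(x)^{-j}$$ be the base $B$ expansion of $1/M$, with digits $a_j\in\mathbb{F}_q[x]$, each $a_j$ being zero or of degree less than $\deg B$. Then the sum of the digits over one period vanishes: $$S_B(M)(x) := a_1(x)+a_2(x)+\cdots+a_T(x) = 0 \quad\text{in } \mathbb{F}_q[x].$$
   Context: Base $B$ expansion: for $B\in\mathbb{F}_q[x]$ of positive degree, every rational function $f\in\mathbb{F}_q(x)$ has an expansion $f(x)=\sum_{j=-\infty}^{J} a_{-j}(x)B(x)^j$ with digits $a_j\in\mathbb{F}_q[x]$ satisfying $\deg a_j<\deg B$ or $a_j=0$. The series converges in the field of formal Laurent series $\mathbb{F}_q((1/x))$, the completion of $\mathbb{F}_q(x)$ with respect to the degree valuation, and the digits are uniquely determined by $f$. When $M$ has positive degree and is coprime to $B$, the expansion of $1/M$ has only the terms $a_jB^{-j}$ with $j\ge1$ and is purely periodic, $\frac1M=0.\overline{a_1a_2\dots a_T}$ (that is, $a_{j+T}=a_j$ for all $j\ge 1$), with minimal period $T$ equal to the order of $B$ in $(\mathbb{F}_q[x]/(M))^*$. The sum of digits is $S_B(M)=a_1+\cdots+a_T$. *)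

(* Defs.v *)
From HB Require Import structures.
From mathcomp Require Import all_boot all_order all_algebra zify.
Set Implicit Arguments.
Unset Strict Implicit.
Unset Printing Implicit Defensive.
Import Order.TTheory GRing.Theory Num.Theory.
Local Open Scope ring_scope.
Local Open Scope quotient_scope.

Local Notation tofrac := (@FracField.tofrac _).
Local Notation "p %:F" := (tofrac p).

(* Degree valuation deg (p / q) = deg p - deg q on F(x); it does not depend on
   the representative (fdeg_div).  Only meaningful for f != 0. *)
Definition fdeg (F : fieldType) (f : {fraction {poly F}}) : int :=
  (size \n_(repr f))%:Z - (size \d_(repr f))%:Z.

Lemma fdeg_div (F : fieldType) (p q : {poly F}) :
  p != 0 -> q != 0 -> fdeg (p%:F / q%:F) = (size p)%:Z - (size q)%:Z.
Proof.
move=> p0 q0; rewrite /fdeg; set f := _ / _.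
set r := repr f; have d0 : \d_r != 0 := denom_ratioP r.
have fE : f * (\d_r)%:F = (\n_r)%:F.
  rewrite -[f]reprK -/r; unlock FracField.tofrac.
  rewrite -[LHS]FracField.pi_mul; apply/eqmodP => /=.
  by rewrite FracField.equivfE /FracField.mulf !numden_Ratio ?mulr1 ?oner_neq0 // mulrC.
have : (\n_r)%:F * q%:F = p%:F * (\d_r)%:F.
  by rewrite -fE mulrAC /f divfK // tofrac_eq0.
move/eqP; rewrite -!tofracM tofrac_eq => /eqP e.
have n0 : \n_r != 0.
  apply/eqP => n0; move/eqP: e.
  by rewrite n0 mul0r eq_sym mulf_eq0 (negPf p0) (negPf d0).
have := congr1 (fun s : {poly F} => size s) e; rewrite !size_mul //.
move: p0 q0 n0 d0; rewrite -!size_poly_gt0.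
move: (size p) (size q) (size \n_r) (size \d_r) => a b c d; lia.
Qed.

(* Convergence for the degree valuation.  The completion F((1/x)) of F(x)
   induces this topology on F(x), so a sequence in F(x) has the limit l of F(x)
   in F((1/x)) exactly when fcvg holds. *)
Definition fcvg (F : fieldType) (u : nat -> {fraction {poly F}})
    (l : {fraction {poly F}}) : Prop :=
  forall n : int, exists N : nat, forall k : nat, (N <= k)%N ->
    u k = l \/ fdeg (u k - l) < n.

(* f = sum_(j >= 1) a_j B^(-j); the value a 0 plays no role.  For B of positive
   degree, size (a j) < size B means that a_j = 0 or deg a_j < deg B. *)
Definition base_expansion (F : fieldType) (B : {poly F})
    (f : {fraction {poly F}}) (a : nat -> {poly F}) : Prop :=
  (forall j : nat, (1 <= j)%N -> (size (a j) < size B)%N) /\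
  fcvg (fun k : nat => \sum_(1 <= j < k.+1) (a j)%:F * B%:F ^- j) f.

(* Makes {poly %/ h} a finite ring with units, hence {unit {poly %/ h}} a finite
   group, for arbitrary h. *)
HB.instance Definition _ (F : finFieldType) (h : {poly F}) :=
  Finite.on {poly %/ h}.

(* The library forms {poly %/ h} for monic nonconstant h only; the monic
   associate of M generates the same ideal as M. *)
Definition monic_assoc (F : fieldType) (M : {poly F}) : {poly F} :=
  (lead_coef M)^-1 *: M.

Lemma in_qpoly_unit (F : fieldType) (M B : {poly F}) :
  (1 < size M)%N -> coprimep M B ->
  in_qpoly (monic_assoc M) B \is a GRing.unit.
Proof.
move=> hM hc.
have l0 : lead_coef M != 0 by rewrite lead_coef_eq0 -size_poly_gt0; apply: ltnW.
have hm : mk_monic (monic_assoc M) = monic_assoc M.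
  by rewrite /mk_monic /monic_assoc size_scale ?invr_eq0 // hM monicE lead_coefZ mulVf ?eqxx.
have hmm := monic_mk_monic (monic_assoc M).
change (coprimep (mk_monic (monic_assoc M))
  (Pdiv.CommonRing.rmodp B (mk_monic (monic_assoc M)))).
rewrite -Pdiv.IdomainMonic.modpE // coprimep_modr hm.
by rewrite /monic_assoc coprimepZl // invr_eq0.
Qed.

(* Main.v *)
(* Clearing denominators in the k-th partial sum of the expansion leaves
   B^k = M P_k + r_k, where P_k is the base B number with digits a_1 ... a_k;
   convergence forces deg r_k < deg M, so r_k is the residue of B^k modulo M.
   Then M a_{k+1} = B r_k - r_{k+1}, and summing over a period, where r_T = r_0,
   gives M S = (B - 1) R with R = r_0 + ... + r_{T-1}. As M is coprime to B - 1,
   it divides R, whose degree is smaller: R = 0, and S = 0. *)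
Require Import Defs.
From mathcomp Require Import all_boot all_order all_fingroup all_algebra.
From mathcomp Require Import zify ring.
Import GRing.Theory.
Local Open Scope ring_scope.

(* [size_mul] over a field: its integral domain instance of [size] on {poly F},
   though convertible to the field one, is a different atom for [lia]. *)
Lemma size_mul_field (F : fieldType) (p q : {poly F}) :
  p != 0 -> q != 0 -> size (p * q) = (size p + size q).-1.
Proof. exact: size_mul. Qed.

Lemma div_sub_inv (K : fieldType) (x y z : K) :
  y != 0 -> z != 0 -> x / y - z^-1 = - (y - z * x) / (z * y).
Proof. by move=> y0 z0; field; rewrite y0 z0. Qed.

Fixpoint digits_value (F : fieldType) (B : {poly F}) (a : nat -> {poly F})
    (k : nat) : {poly F} :=
  if k is k'.+1 then B * digits_value F B a k' + a k else 0.
Arguments digits_value {F} B a k.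

(** Not defined as [B ^+ k %% M]: its congruence to [B ^+ k] is immediate, and the degree bound is
    what convergence has to supply. *)
Definition expansion_rem {F : fieldType} (B M : {poly F}) (a : nat -> {poly F})
    (k : nat) : {poly F} :=
  B ^+ k - M * digits_value B a k.

Lemma digits_value_frac (F : fieldType) (B : {poly F}) (a : nat -> {poly F})
    (k : nat) : B != 0 ->
  \sum_(1 <= j < k.+1) FracField.tofrac (a j) * FracField.tofrac B ^- j =
  FracField.tofrac (digits_value B a k) / FracField.tofrac B ^+ k.
Proof.
move=> B0; have b0 : FracField.tofrac B != 0 by rewrite tofrac_eq0.
elim: k => [|k IHk]; first by rewrite big_geq // tofrac0 mul0r.
rewrite big_nat_recr //= IHk tofracD tofracM mulrDl; congr (_ + _).
by rewrite exprS invfM mulrACA divff // mul1r.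
Qed.

(** [E] is the number written with the [m] digits after the [k]-th; digits of degree below deg B
    keep it below [B ^+ m]. *)
Lemma digits_value_add (F : fieldType) (B : {poly F}) (a : nat -> {poly F})
    (k m : nat) :
    (1 < size B)%N -> (forall j, (1 <= j)%N -> (size (a j) < size B)%N) ->
  exists2 E, digits_value B a (k + m) = B ^+ m * digits_value B a k + E &
    (size E < size (B ^+ m)%R)%N.
Proof.
move=> hB ha; have B0 : B != 0 by rewrite -size_poly_gt0; lia.
elim: m => [|m [E Ek hE]].
  by exists 0; rewrite ?addn0 ?mul1r ?addr0 // size_poly0 size_poly1.
exists (B * E + a (k + m).+1); first by rewrite addnS /= Ek exprS; ring.
have Bm0 : B ^+ m != 0 by rewrite expf_neq0.
have := ha (k + m).+1 isT; rewrite exprS size_mul_field // => hak.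
move: Bm0; rewrite -size_poly_gt0 => Bm0.
have hBE : (size (B * E)%R <= (size B + size E).-1)%N by exact: size_polyMleq.
by rewrite (leq_ltn_trans (size_polyD _ _)) // gtn_max; lia.
Qed.

(* Convergence only bounds r_{k+m} for m large; this descends to r_k because
   B^m r_k = r_{k+m} + M E with deg E < deg B^m. *)
Lemma size_expansion_rem (F : fieldType) (B M : {poly F})
    (a : nat -> {poly F}) (k : nat) :
    (1 < size B)%N -> M != 0 -> base_expansion B (FracField.tofrac M)^-1 a ->
  (size (expansion_rem B M a k) < size M)%N.
Proof.
move=> hB M0 [ha hcvg]; have B0 : B != 0 by rewrite -size_poly_gt0; lia.
have M0' : (0 < size M)%N by rewrite size_poly_gt0.
have Bn0 n : B ^+ n != 0 by rewrite expf_neq0.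
have Bn0' n : (0 < size (B ^+ n)%R)%N by rewrite size_poly_gt0.
(* The error of the partial sum at [k + m] is -r_{k+m} / (M B^{k+m}). Requiring its degree to be
   below -deg B^k gives deg r_{k+m} < deg M + deg B^m. *)
have [N hN] := hcvg (1 - (size (B ^+ k))%:Z).
have [m hm] : exists m, (N <= k + m)%N by exists N; lia.
have hr : (size (expansion_rem B M a (k + m)%N) < size M + (size (B ^+ m)%R).-1)%N.
  have [->|r0] := eqVneq (expansion_rem B M a (k + m)%N) 0.
    by rewrite size_poly0; lia.
  have m0 : FracField.tofrac M != 0 by rewrite tofrac_eq0.
  have bn0 : FracField.tofrac (B ^+ (k + m)) != 0 by rewrite tofrac_eq0.
  have diffE : \sum_(1 <= j < (k + m).+1)
      FracField.tofrac (a j) * FracField.tofrac B ^- j - (FracField.tofrac M)^-1 =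
    FracField.tofrac (- expansion_rem B M a (k + m)%N) /
      FracField.tofrac (M * B ^+ (k + m)).
    rewrite digits_value_frac // -tofracXn /expansion_rem.
    rewrite tofracN tofracB !tofracM.
    exact: (div_sub_inv _ _ _ _ bn0 m0).
  have := hN _ hm; rewrite diffE fdeg_div ?oppr_eq0 ?mulf_neq0 // size_polyN.
  case.
    (* A partial sum equal to 1/M would force r_{k+m} = 0. *)
    move/eqP; rewrite -subr_eq0 diffE mulf_eq0 invr_eq0 !tofrac_eq0 oppr_eq0.
    by rewrite (negPf r0) mulf_eq0 (negPf M0) (negPf (Bn0 _)).
  rewrite exprD !size_mul_field ?mulf_neq0 //.
  move: (Bn0' k) (Bn0' m) M0'; clear.
  by move: (size _) (size M) (size (B ^+ k)) (size (B ^+ m)) => d s x y; lia.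
have [E Ekm hE] := digits_value_add _ _ _ k m hB ha.
have remE : B ^+ m * expansion_rem B M a k = expansion_rem B M a (k + m)%N + M * E.
  by rewrite /expansion_rem Ekm exprD; ring.
have [->|rk0] := eqVneq (expansion_rem B M a k) 0; first by rewrite size_poly0.
have hME : (size (M * E)%R <= (size M + size E).-1)%N by exact: size_polyMleq.
have : (size (B ^+ m * expansion_rem B M a k)%R < size M + (size (B ^+ m)%R).-1)%N.
  by rewrite remE (leq_ltn_trans (size_polyD _ _)) // gtn_max hr; move: (Bn0' m); lia.
by rewrite size_mul_field //; move: (Bn0' m); lia.
Qed.

(** Summing M a_{j+1} = B r_j - r_{j+1} telescopes up to the boundary term r_0 - r_k, where r_0 =
    1. *)
Lemma sum_digits_expansion_rem (F : fieldType) (B M : {poly F})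
    (a : nat -> {poly F}) (k : nat) :
  M * \sum_(1 <= j < k.+1) a j =
  (B - 1) * (\sum_(i < k) expansion_rem B M a i) + 1 - expansion_rem B M a k.
Proof.
elim: k => [|k IHk].
  by rewrite big_geq // big_ord0 /expansion_rem /= expr0; ring.
rewrite big_nat_recr //= mulrDr IHk big_ord_recr /= /expansion_rem /= exprS.
by ring.
Qed.

Lemma in_qpoly_monic_assoc_eq (F : fieldType) (M p q : {poly F}) :
    (1 < size M)%N ->
    in_qpoly (monic_assoc M) p = in_qpoly (monic_assoc M) q ->
  M %| p - q.
Proof.
move=> hM pq.
have l0 : lead_coef M != 0 by rewrite lead_coef_eq0 -size_poly_gt0; lia.
(* The quotient reduces modulo [mk_monic], which fixes monic nonconstant polynomials. *)
have hm : mk_monic (monic_assoc M) = monic_assoc M.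
  rewrite /mk_monic /monic_assoc size_scale ?invr_eq0 // hM.
  by rewrite monicE lead_coefZ mulVf ?eqxx.
have := congr1 val pq => /= {}pq.
rewrite -(dvdpZl _ _ (c := (lead_coef M)^-1)) ?invr_eq0 //.
rewrite -[_ *: M]/(monic_assoc M) -hm Pdiv.Field.dvdpE.
have hmm := monic_mk_monic (monic_assoc M).
by rewrite /Pdiv.Ring.rdvdp Pdiv.RingMonic.rmodpB // pq subrr.
Qed.

Theorem theorem1 (F : finFieldType) (B M : {poly F})
  (hB : (1 < size B)%N) (hM : (1 < size M)%N)
  (hcop : coprimep M (B * (B - 1)))
  (u : {unit {poly %/ monic_assoc M}})
  (hu : val u = in_qpoly (monic_assoc M) B)
  (T : nat) (hT : T = #[u]%g)
  (a : nat -> {poly F}) (ha : base_expansion B (FracField.tofrac M)^-1 a) :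
  \sum_(1 <= j < T.+1) a j = 0.
Proof.
have M0 : M != 0 by rewrite -size_poly_gt0; lia.
have hsize k := size_expansion_rem _ _ _ _ k hB M0 ha.
have small p : M %| p -> (size p < size M)%N -> p = 0.
  move=> Mp; apply: contraTeq => p0.
  by rewrite -leqNgt dvdp_leq.
have BT : M %| B ^+ T - 1.
  apply: in_qpoly_monic_assoc_eq => //.
  have : val (u ^+ T)%g = 1 by rewrite hT expg_order.
  rewrite FinRing.val_unitX hu in_qpoly1 => uT.
  exact: etrans (rmorphXn (in_qpoly (monic_assoc M)) T B) uT.
(* r_T and 1 are congruent modulo M and both of degree below deg M, hence equal; this cancels the
   boundary term. *)
have rT : expansion_rem B M a T = 1.
  apply/eqP; rewrite -subr_eq0; apply/eqP/small.
    by rewrite /expansion_rem addrAC dvdp_sub // dvdp_mulr.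
  by rewrite (leq_ltn_trans (size_polyD _ _)) // size_polyN size_poly1 gtn_max hsize.
have := sum_digits_expansion_rem _ B M a T.
rewrite rT addrK; set R := \sum_(i < T) _ => MS.
have R0 : R = 0.
  apply: small.
    move: hcop; rewrite coprimepMr => /andP[_ hc].
    by rewrite -(Gauss_dvdpr _ hc) -MS dvdp_mulr.
  (* The degree bound on each remainder passes to their sum. *)
  apply: (big_ind (fun p : {poly F} => (size p < size M)%N)) => // [|p q hp hq].
    by rewrite size_poly0; lia.
  by rewrite (leq_ltn_trans (size_polyD _ _)) // gtn_max hp.
by move/eqP: MS; rewrite R0 mulr0 mulf_eq0 (negPf M0) => /eqP.
Qed.
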